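(* For all integers $n\ge k\ge 4$, there is no $k$-balanced permutation in $\mathbb{S}_n$.
   Context: $\mathbb{S}_n$ is the set of permutations of $[n]=\{1,\dots,n\}$. For $\pi\in\mathbb{S}_n$, $\tau\in\mathbb{S}_k$ with $k\le n$, and $S=\{s_1<\dots<s_k\}\subseteq[n]$, write $\pi(S)\cong\tau$ if for all $i,j\in[k]$: $\pi(s_i)<\pi(s_j)\iff\tau(i)<\tau(j)$. Let $\#\tau(\pi)$ be the number of $k$-element sets $S\subseteq[n]$ with $\pi(S)\cong\tau$. A permutation $\pi\in\mathbb{S}_n$ is $k$-balanced ($1\le k\le n$) if $\#\tau(\pi)=\binom{n}{k}/k!$ for every $\tau\in\mathbb{S}_k$. *)

(* Defs.v *)
From mathcomp Require Import all_boot all_order all_fingroup all_algebra.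

Set Implicit Arguments.
Unset Strict Implicit.
Unset Printing Implicit Defensive.

(* Positions and values are numbered from 0: [n] is represented by 'I_n. *)

(* pi(S) ~ tau.  The witness s is the increasing enumeration
   s_0 < ... < s_(k-1) of S; such an enumeration is unique, and exists iff
   #|S| = k. *)
Definition order_iso (n k : nat) (pi : 'S_n) (S : {set 'I_n}) (tau : 'S_k)
    : bool :=
  [exists s : {ffun 'I_k -> 'I_n},
    [&& [forall i : 'I_k, forall j : 'I_k, (i < j) ==> (s i < s j)],
        S == [set s i | i : 'I_k] &
        [forall i : 'I_k, forall j : 'I_k,
          (pi (s i) < pi (s j)) == (tau i < tau j)]]].

Definition occurrences (n k : nat) (tau : 'S_k) (pi : 'S_n) : nat :=
  #|[set S : {set 'I_n} | (#|S| == k) && order_iso pi S tau]|.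

(* The quotient is taken in rat, not with truncated division.  The definition
   is meaningful only for 1 <= k <= n: if n < k, both sides are 0. *)
Definition balanced (n k : nat) (pi : 'S_n) : Prop :=
  forall tau : 'S_k,
    ((occurrences tau pi)%:R = 'C(n, k)%:R / k`!%:R :> rat)%R.

(* Main.v *)
Require Import Defs.
From mathcomp Require Import all_boot all_order all_fingroup all_algebra.

(** The obstruction is the variance of the number of inversions, inv.

    Give each pattern tau of length k a weight f tau, and let F sigma be the
    sum of f over the patterns of sigma on all k-element sets of positions.
    Each k-set of positions sees every pattern equally often as sigma runs
    over 'S_n, so the mean of F is the one that F would have if all patterns
    occurred equally often in sigma.  Hence, if pi is balanced, F pi is the
    mean of F over 'S_n ([pattern_sum_mean]).

    Now inv is a sum over pairs of positions, so for any constant c the square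
    (inv - c)^2 is a sum over quadruples of positions.  As k >= 4, every
    quadruple fits into a k-set, and (inv - c)^2 is such an F
    ([pattern_sum_square]).  Take c = inv pi: the mean of (inv - c)^2 is its
    value at pi, which is 0.  So inv is constant on 'S_n, although the
    identity has no inversion and every transposition has some. *)

Set Implicit Arguments.
Unset Strict Implicit.
Unset Printing Implicit Defensive.

Import GRing.Theory Num.Theory.

(** * Increasing enumerations and patterns *)

Section Patterns.

Variables (n k : nat).

Definition increasing (s : 'I_k -> 'I_n) := forall i j : 'I_k, i < j -> s i < s j.

Definition same_order (g : 'I_k -> 'I_n) (tau : 'S_k) :=
  [forall i : 'I_k, forall j : 'I_k, (g i < g j) == (tau i < tau j)].

Lemma same_orderP (g : 'I_k -> 'I_n) (tau : 'S_k) :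
  reflect (forall i j : 'I_k, (g i < g j) = (tau i < tau j)) (same_order g tau).
Proof.
by apply: (iffP 'forall_'forall_eqP).
Qed.

Lemma increasing_ltE (s : 'I_k -> 'I_n) :
  increasing s -> forall i j : 'I_k, (s i < s j) = (i < j).
Proof.
move=> s_inc i j; case: (ltngtP i j) => [/s_inc-> // | /s_inc sji | /val_inj->].
  by rewrite ltnNge (ltnW sji).
by rewrite ltnn.
Qed.

Lemma increasing_inj (s : 'I_k -> 'I_n) : increasing s -> injective s.
Proof.
move=> s_inc i j eq_s; apply: val_inj.
by case: (ltngtP i j) => // /s_inc; rewrite eq_s ltnn.
Qed.

Lemma card_ord_lt (i : 'I_k) : #|[set j : 'I_k | j < i]| = i.
Proof.
have le_ik := ltnW (ltn_ord i).
have -> : [set j : 'I_k | j < i] = [set widen_ord le_ik j | j : 'I_i].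
  apply/setP => j; rewrite inE; apply/idP/imsetP => [lt_ji | [j' _ ->] /=].
    by exists (Ordinal lt_ji) => //; apply/val_inj.
  exact: ltn_ord.
by rewrite card_imset ?card_ord // => x y /(congr1 val) /= /val_inj.
Qed.

Lemma increasing_rank (s : 'I_k -> 'I_n) (i : 'I_k) :
  increasing s -> #|[set x in [set s j | j : 'I_k] | x < s i]| = i.
Proof.
move=> s_inc; rewrite -[RHS]card_ord_lt -(card_imset _ (increasing_inj s_inc)).
congr #|pred_of_set _|; apply/setP => x; rewrite inE.
apply/andP/imsetP => [[/imsetP[j _ ->]] | [j]].
  by rewrite increasing_ltE // => lt_ji; exists j; rewrite ?inE.
by rewrite inE => lt_ji ->; rewrite imset_f ?increasing_ltE.
Qed.

(** The index of an entry is its rank in the image, hence determined by it. *)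
Lemma increasing_unique (s t : 'I_k -> 'I_n) :
    increasing s -> increasing t ->
  [set s i | i : 'I_k] = [set t i | i : 'I_k] -> s =1 t.
Proof.
move=> s_inc t_inc eq_im i.
have /imsetP[j _ si_tj] : s i \in [set t i | i : 'I_k] by rewrite -eq_im imset_f.
rewrite si_tj; congr (t _); apply/esym/val_inj.
by rewrite /= -(increasing_rank i s_inc) -(increasing_rank j t_inc) eq_im si_tj.
Qed.

(** The pattern of an injective word sends each position to the number of
    smaller letters. *)
Lemma pattern_exists (g : 'I_k -> 'I_n) :
  injective g -> exists tau : 'S_k, same_order g tau.
Proof.
move=> g_inj; pose below i := [set j | g j < g i].
have below_bound i : #|below i| < k.
  rewrite -[X in _ < X]card_ord -cardsT; apply: proper_card.
  by apply/properP; split; [exact: subsetT | exists i; rewrite // inE ltnn].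
pose r i := Ordinal (below_bound i).
have r_mono i j : g i < g j -> r i < r j.
  move=> lt_ij; apply: proper_card; apply/properP; split.
    by apply/subsetP => x; rewrite !inE => /ltn_trans->.
  by exists i; rewrite !inE ?ltnn.
have r_ltE i j : (g i < g j) = (r i < r j).
  case: (ltngtP (g i) (g j)) => [/r_mono-> //|/r_mono lt_r|/val_inj/g_inj->].
    by rewrite ltnNge (ltnW lt_r).
  by rewrite ltnn.
have r_inj : injective r.
  move=> i j eq_r; apply/g_inj/val_inj.
  by case: (ltngtP (g i) (g j)) => // /r_mono; rewrite eq_r ltnn.
by exists (perm r_inj); apply/same_orderP => i j; rewrite !permE r_ltE.
Qed.

End Patterns.

(** Two patterns of g differ by an increasing bijection of 'I_k, that is, by the
    identity. *)
Lemma pattern_unique (n k : nat) (g : 'I_k -> 'I_n) (tau tau' : 'S_k) :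
  same_order g tau -> same_order g tau' -> tau = tau'.
Proof.
move=> /same_orderP h /same_orderP h'.
have inc : increasing (fun i => tau' ((tau^-1)%g i)).
  by move=> i j lt_ij; rewrite -h' h !permKV.
apply/permP => i; rewrite -[in RHS](permK tau i).
apply: (@increasing_unique _ _ id _ _ inc _ (tau i)) => //.
apply/setP => x; rewrite (imset_f id) //; apply/esym/imsetP.
by exists (tau ((tau'^-1)%g x)); rewrite // permK permKV.
Qed.

(** Standardizing an arbitrary enumeration of the set sorts it. *)
Lemma increasing_enumeration (n k : nat) (S : {set 'I_n}) :
  #|S| = k -> exists2 s : 'I_k -> 'I_n, increasing s & S = [set s i | i : 'I_k].
Proof.
move=> card_S; pose g (i : 'I_k) : 'I_n := enum_val (cast_ord (esym card_S) i).
have g_inj : injective g by move=> i j /enum_val_inj/cast_ord_inj.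
have [tau /same_orderP g_tau] := pattern_exists g_inj.
exists (fun i => g ((tau^-1)%g i)).
  by move=> i j lt_ij; rewrite g_tau !permKV.
have sinj : injective (fun i => g ((tau^-1)%g i)).
  by move=> i j /g_inj/perm_inj.
apply/esym/eqP; rewrite eqEcard card_imset // card_ord card_S leqnn andbT.
by apply/subsetP => _ /imsetP[i _ ->]; apply: enum_valP.
Qed.

Lemma order_isoE (n k : nat) (s : 'I_k -> 'I_n) (sigma : 'S_n) (tau : 'S_k) :
    increasing s ->
  order_iso sigma [set s i | i : 'I_k] tau = same_order (fun i => sigma (s i)) tau.
Proof.
move=> s_inc; apply/existsP/same_orderP => [[t] | h].
  case/and3P=> /'forall_'forall_implyP t_inc /eqP im_t /'forall_'forall_eqP iso i j.
  have st := increasing_unique s_inc t_inc im_t.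
  by rewrite !st; apply: iso.
exists (finfun s); apply/and3P; split.
- by apply/'forall_'forall_implyP => i j; rewrite !ffunE; apply: s_inc.
- by apply/eqP/eq_imset => i; rewrite ffunE.
- by apply/'forall_'forall_eqP => i j; rewrite !ffunE h.
Qed.

Lemma order_iso_pred1 (n k : nat) (s : 'I_k -> 'I_n) (sigma : 'S_n) :
    increasing s ->
  exists2 tau : 'S_k, same_order (fun i => sigma (s i)) tau
    & order_iso sigma [set s i | i : 'I_k] =1 pred1 tau.
Proof.
move=> s_inc; have [|tau h] := @pattern_exists n k (fun i => sigma (s i)).
  by move=> i j /perm_inj/(increasing_inj s_inc).
exists tau => // tau'; rewrite /= order_isoE //.
by apply/idP/eqP => [h' | -> //]; apply: pattern_unique h' h.
Qed.

(** * Pattern statistics averaged over all permutations *)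

Section Statistics.

Local Open Scope ring_scope.

(** The action of a permutation of the indices of an injective family is
    realized on the ambient set; transpositions suffice. *)
Lemma perm_extend (n k : nat) (s : 'I_k -> 'I_n) (rho : 'S_k) :
  injective s -> exists p : 'S_n, forall i, p (s i) = s (rho i).
Proof.
move=> s_inj; have [ts -> _] := prod_tpermP rho.
elim: ts => [|t ts [p hp]].
  by exists 1%g => i; rewrite big_nil !perm1.
exists (tperm (s t.1) (s t.2) * p)%g => i.
by rewrite big_cons !permM -inj_tperm // hp.
Qed.

Definition pattern_sum (n k : nat) (f : 'S_k -> rat) (sigma : 'S_n) : rat :=
  \sum_(S : {set 'I_n} | #|S| == k) \sum_(tau | order_iso sigma S tau) f tau.

Lemma pattern_sum_balanced (n k : nat) (f : 'S_k -> rat) (pi : 'S_n) :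
    balanced k pi ->
  pattern_sum f pi = 'C(n, k)%:R / k`!%:R * \sum_tau f tau.
Proof.
move=> pi_bal; rewrite /pattern_sum.
rewrite (exchange_big_dep predT) //= mulr_sumr; apply: eq_bigr => tau _.
by rewrite -(pi_bal tau) sumr_const mulr_natl /occurrences cardsE.
Qed.

(** Precomposing with an extension of rho maps the permutations of pattern tau
    on S injectively to those of pattern rho * tau, so all the k`! patterns on
    S are equally frequent. *)
Lemma card_order_iso (n k : nat) (S : {set 'I_n}) (tau : 'S_k) :
  #|S| = k -> #|[set sigma : 'S_n | order_iso sigma S tau]|%:R
              = n`!%:R / k`!%:R :> rat.
Proof.
case/increasing_enumeration=> s s_inc ->; have s_inj := increasing_inj s_inc.
pose N (tau : 'S_k) :=
  #|[set sigma : 'S_n | order_iso sigma [set s i | i : 'I_k] tau]|.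
have N_le rho t : (N t <= N (rho * t)%g)%N.
  have [p ps] := perm_extend rho s_inj.
  rewrite /N -(card_imset _ (mulgI p)); apply/subset_leq_card/subsetP.
  move=> _ /imsetP[sigma + ->]; rewrite !inE !order_isoE // => /same_orderP h.
  by apply/same_orderP => i j; rewrite !permM !ps h.
have N_const t : N t = N tau.
  have N_le2 a b : (N a <= N b)%N by rewrite -[b](mulgKV a); apply: N_le.
  by apply: anti_leq; rewrite !N_le2.
have N_sum : (\sum_t N t = n`!)%N.
  transitivity (\sum_(sigma : 'S_n) 1)%N; last by rewrite sum1_card card_Sn.
  under eq_bigr => t _ do rewrite /N -sum1dep_card.
  rewrite (exchange_big_dep predT) //=; apply: eq_bigr => sigma _.
  have [t _ iso_t] := order_iso_pred1 sigma s_inc.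
  exact: big_pred1 iso_t.
have k0 : k`!%:R != 0 :> rat by rewrite pnatr_eq0 -lt0n fact_gt0.
apply: (canRL (mulfK k0)).
rewrite -natrM -N_sum (eq_bigr _ (fun t _ => N_const t)) sum_nat_const.
by rewrite card_Sn mulnC.
Qed.

Lemma pattern_sum_mean (n k : nat) (f : 'S_k -> rat) (pi : 'S_n) :
    balanced k pi ->
  \sum_(sigma : 'S_n) pattern_sum f sigma = n`!%:R * pattern_sum f pi.
Proof.
move=> /pattern_sum_balanced->; rewrite /pattern_sum exchange_big /=.
transitivity (\sum_(S : {set 'I_n} | #|S| == k)
                 n`!%:R / k`!%:R * \sum_(tau : 'S_k) f tau).
  apply: eq_bigr => S /eqP card_S; rewrite (exchange_big_dep predT) //=.
  rewrite mulr_sumr; apply: eq_bigr => tau _.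
  by rewrite -(card_order_iso tau card_S) sumr_const mulr_natl cardsE.
rewrite sumr_const -cardsE card_draws card_ord -[LHS]mulr_natl !mulrA.
by rewrite -!mulrA mulrCA.
Qed.

(** * The square of the number of inversions *)

(** For t = 0 this is the indicator of an inversion at the positions i < j.
    The shift t, spread evenly over all pairs, lets the quadratic statistic
    below absorb the linear and constant terms of (inv - c)^2. *)
Definition shifted_inversion (n : nat) (t : rat) (sigma : 'S_n) (i j : 'I_n)
    : rat :=
  ((i < j) && (sigma j < sigma i))%N%:R - t.

Definition shifted_inversions (n : nat) (t : rat) (sigma : 'S_n) : rat :=
  \sum_i \sum_j shifted_inversion t sigma i j.

Lemma card_supersets (n k : nat) (T : {set 'I_n}) : (#|T| <= k)%N ->
  #|[set S : {set 'I_n} | (#|S| == k) && (T \subset S)]|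
  = 'C(n - #|T|, k - #|T|).
Proof.
move=> le_Tk; have -> : (n - #|T| = #|~: T|)%N.
  by rewrite [RHS]cardsCs setCK card_ord.
rewrite -cards_draws.
pose D := [set A : {set 'I_n} | A \subset ~: T & #|A| == (k - #|T|)%N].
rewrite -/D.
have D_disj A : A \in D -> A :&: T = set0.
  by rewrite inE => /andP[AT _]; apply/eqP; rewrite setI_eq0 disjoints_subset.
have <- : [set A :|: T | A in D]
        = [set S : {set 'I_n} | (#|S| == k) && (T \subset S)].
  apply/setP => S; rewrite inE; apply/imsetP/andP => [[A AD ->] | [/eqP cS TS]].
    rewrite subsetUr cardsU D_disj // cards0 subn0.
    by move: AD; rewrite inE => /andP[_ /eqP->]; rewrite subnK.
  exists (S :\: T).
    by rewrite inE setDE subsetIr -setDE cardsDS // cS eqxx.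
  by rewrite setUC -{1}(setIidPr TS) setID.
rewrite card_in_imset // => A B AD BD eqU.
have UK C : C \in D -> (C :|: T) :\: T = C.
  by move=> CD; rewrite setDUl setDv setU0; apply/setDidPl; rewrite -setI_eq0 D_disj.
by rewrite -(UK A AD) eqU UK.
Qed.

Lemma card_set4 (T : finType) (a b c d : T) : (#|[set a; b; c; d]| <= 4)%N.
Proof.
by rewrite -[4%N]/(size [:: a; b; c; d]) (leq_trans _ (card_size _)) //;
  apply/subset_leq_card/subsetP => x; rewrite !inE -!orbA.
Qed.

(** Four positions lie together in 'C(n - m, k - m) sets of size k, m being
    their number without repetition; dividing by this multiplicity makes each
    quadruple count once when the terms are summed over the k-subsets.  The
    ambient size n is separate from the size n' of the permutation, since the
    same weights are used for a permutation and for its patterns. *)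
Definition weighted_product (n' n k : nat) (t : rat) (sigma : 'S_n')
    (a b c d : 'I_n') : rat :=
  let m := #|[set a; b; c; d]| in
  shifted_inversion t sigma a b * shifted_inversion t sigma c d
    / ('C(n - m, k - m))%:R.

Definition square_weight (n k : nat) (t : rat) (tau : 'S_k) : rat :=
  \sum_a \sum_b \sum_c \sum_d weighted_product n k t tau a b c d.

Lemma square_weightE (n k : nat) (t : rat) (s : 'I_k -> 'I_n)
    (S : {set 'I_n}) (sigma : 'S_n) (tau : 'S_k) :
    increasing s -> S = [set s i | i : 'I_k] ->
    same_order (fun i => sigma (s i)) tau ->
  square_weight n t tau
  = \sum_(a in S) \sum_(b in S) \sum_(c in S) \sum_(d in S)
       weighted_product n k t sigma a b c d.
Proof.
move=> s_inc -> /same_orderP h; have s_inj := increasing_inj s_inc.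
have sumS (F : 'I_n -> rat) :
    \sum_(x in [set s i | i : 'I_k]) F x = \sum_i F (s i).
  by rewrite big_imset //= => i j _ _ /s_inj.
rewrite sumS; apply: eq_bigr => a _; rewrite sumS; apply: eq_bigr => b _.
rewrite sumS; apply: eq_bigr => c _; rewrite sumS; apply: eq_bigr => d _.
have eq_inv i j :
    shifted_inversion t tau i j = shifted_inversion t sigma (s i) (s j).
  by rewrite /shifted_inversion (increasing_ltE s_inc) h.
rewrite /weighted_product !eq_inv -(card_imset _ s_inj).
by rewrite !imsetU !imset_set1.
Qed.

(** Each quadruple of positions lies in some k-set because k >= 4, so the
    expanded square can be grouped by the k-sets, and the part supported on a
    k-set depends only on the pattern there. *)
Lemma pattern_sum_square (n k : nat) (t : rat) (sigma : 'S_n) :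
    (4 <= k)%N -> (k <= n)%N ->
  pattern_sum (@square_weight n k t) sigma = shifted_inversions t sigma ^+ 2.
Proof.
move=> k4 kn; rewrite /pattern_sum.
pose W := weighted_product n k t sigma.
transitivity (\sum_(S : {set 'I_n} | #|S| == k)
   \sum_a \sum_b \sum_c \sum_(d | [set a; b; c; d] \subset S) W a b c d).
  apply: eq_bigr => S /eqP card_S.
  have [s s_inc S_s] := increasing_enumeration card_S.
  have [tau h iso_tau] := order_iso_pred1 sigma s_inc.
  rewrite {1}S_s (big_pred1 tau iso_tau).
  rewrite (square_weightE t s_inc S_s h) big_mkcond; apply: eq_bigr => a _.
  rewrite [RHS](_ : _ = if a \in S then
      \sum_b \sum_c \sum_(d | [set a; b; c; d] \subset S) W a b c d else 0).
    case: ifP => // aS; rewrite big_mkcond; apply: eq_bigr => b _.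
    case: ifP => bS.
      rewrite big_mkcond; apply: eq_bigr => c _; case: ifP => cS.
        by apply: eq_bigl => d; rewrite !subUset !sub1set aS bS cS.
      by rewrite big_pred0 // => d; rewrite !subUset !sub1set cS andbF.
    rewrite big1 // => c _.
    by rewrite big_pred0 // => d; rewrite !subUset !sub1set bS andbF.
  case: ifP => // aS; rewrite big1 // => b _; rewrite big1 // => c _.
  by rewrite big_pred0 // => d; rewrite !subUset !sub1set aS.
rewrite exchange_big /= expr2 {1}/shifted_inversions mulr_suml.
apply: eq_bigr => a _; rewrite exchange_big mulr_suml; apply: eq_bigr => b _.
rewrite exchange_big mulr_sumr; apply: eq_bigr => c _.
rewrite (exchange_big_dep predT) //= mulr_sumr; apply: eq_bigr => d _.
have m4 := card_set4 a b c d.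
rewrite sumr_const -cardsE card_supersets ?(leq_trans m4) //.
rewrite /W /weighted_product /= -[LHS]mulr_natr divfK //.
by rewrite pnatr_eq0 -lt0n bin_gt0 leq_sub2r.
Qed.

Lemma shifted_inversionsE (n : nat) (t : rat) (sigma : 'S_n) :
  shifted_inversions t sigma = shifted_inversions 0 sigma - t * (n * n)%:R.
Proof.
rewrite /shifted_inversions /shifted_inversion.
under eq_bigr => i _ do rewrite sumrB sumr_const card_ord.
under [in RHS]eq_bigr => i _ do under eq_bigr => j _ do rewrite subr0.
by rewrite sumrB sumr_const card_ord -mulrnA mulr_natr.
Qed.

Lemma balanced_inversions_const (n k : nat) (pi sigma : 'S_n) :
    (4 <= k)%N -> (k <= n)%N -> balanced k pi ->
  shifted_inversions 0 sigma = shifted_inversions 0 pi.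
Proof.
move=> k4 kn pi_bal.
have nn0 : (n * n)%:R != 0 :> rat.
  by rewrite pnatr_eq0 muln_eq0 orbb -lt0n (leq_trans _ kn) // (leq_trans _ k4).
(* The shift t is subtracted once for each of the n * n pairs of positions. *)
pose t : rat := shifted_inversions 0 pi / (n * n)%:R.
have centred (rho : 'S_n) : shifted_inversions t rho
    = shifted_inversions 0 rho - shifted_inversions 0 pi.
  by rewrite (shifted_inversionsE t) /t divfK.
have sum0 : \sum_(rho : 'S_n) shifted_inversions t rho ^+ 2 = 0.
  under eq_bigr => rho _ do rewrite -(pattern_sum_square t rho k4 kn).
  rewrite (pattern_sum_mean _ pi_bal) pattern_sum_square // centred subrr.
  by rewrite expr0n mulr0.
apply/eqP; rewrite -subr_eq0 -centred -sqrf_eq0; apply/eqP.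
by apply: (psumr_eq0P _ sum0) => // rho _; apply: sqr_ge0.
Qed.

Lemma inversions_id (n : nat) : shifted_inversions 0 (1%g : 'S_n) = 0.
Proof.
apply: big1 => i _; apply: big1 => j _.
by rewrite /shifted_inversion !perm1 subr0; case: ltngtP.
Qed.

Lemma inversions_tperm_gt0 (n : nat) (i j : 'I_n) :
  (i < j)%N -> shifted_inversions 0 (tperm i j) > 0.
Proof.
move=> lt_ij; have ge0 a b : 0 <= shifted_inversion 0 (tperm i j) a b.
  by rewrite /shifted_inversion subr0 ler0n.
rewrite /shifted_inversions (bigD1 i) //= (bigD1 j) //= -addrA.
rewrite {1}/shifted_inversion tpermL tpermR lt_ij subr0 ltr_pwDl ?ltr01 //.
by rewrite addr_ge0 ?sumr_ge0 // => a _; rewrite sumr_ge0.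
Qed.

End Statistics.

Theorem theorem2 (n k : nat) (hk : 4 <= k) (hkn : k <= n) :
  ~ exists pi : 'S_n, balanced k pi.
Proof.
move=> [pi pi_bal].
have n4 : 4 <= n := leq_trans hk hkn.
pose i0 : 'I_n := Ordinal (leq_trans (isT : 0 < 4) n4).
pose i1 : 'I_n := Ordinal (leq_trans (isT : 1 < 4) n4).
have := @inversions_tperm_gt0 n i0 i1 isT.
have const sigma := balanced_inversions_const sigma hk hkn pi_bal.
by rewrite const -(const 1%g) inversions_id Order.POrderTheory.ltxx.
Qed.
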